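(* The hypercube graph associahedron of the $2K_n$ hypercube graph is combinatorially isomorphic to the type $A_n$ permutahedron.
   Context: Let $\pm[n]=\{-n,\dots,-1,1,\dots,n\}$. The $2K_n$ hypercube graph is the graph on $\pm[n]$ consisting of a complete graph on $\{1,\dots,n\}$ and a complete graph on $\{-1,\dots,-n\}$, with no other edges. For a hypercube graph, a tube is a nonempty subset of $\pm[n]$ inducing a connected subgraph and containing no pair $\{i,-i\}$. Two tubes are weakly compatible if one is contained in the other, or they are disjoint with no edge between them. A tubing is a set of pairwise weakly compatible tubes whose union contains no pair $\{i,-i\}$. The hypercube graph associahedron is the simple $n$-dimensional polytope (up to combinatorial isomorphism) whose dual simplicial complex (sets of facets with nonempty intersection) is isomorphic to the complex of tubings. The type $A_n$ permutahedron is the convex hull of the orbit of a generic point under the symmetric group $\mathfrak{S}_{n+1}$ (the type $A_n$ reflection group); it is $n$-dimensional. Combinatorially isomorphic means having face lattices related by a dimension-preserving isomorphism. *)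

(* Defs.v *)
From HB Require Import structures.
From mathcomp Require Import all_boot all_order all_algebra all_fingroup.
From mathcomp Require Import boolp classical_sets functions cardinality reals.

Set Implicit Arguments.
Unset Strict Implicit.
Unset Printing Implicit Defensive.

Import Order.TTheory GRing.Theory Num.Theory.

Local Open Scope classical_set_scope.
Local Open Scope ring_scope.

Section Polytopes.
Variables (R : realType) (d : nat).
Implicit Types (A P F G : set 'rV[R]_d) (v : 'rV[R]_d).

Definition conv_hull A : set 'rV[R]_d :=
  [set x | exists (m : nat) (p : 'I_m -> 'rV[R]_d) (w : 'I_m -> R),
     [/\ forall i, A (p i), forall i, 0 <= w i, \sum_i w i = 1
       & x = \sum_i w i *: p i]].

Definition is_polytope P : Prop :=
  exists V : seq 'rV[R]_d, P = conv_hull [set` V].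

Definition aff_indep (m : nat) (p : 'I_m -> 'rV[R]_d) : Prop :=
  forall c : 'I_m -> R,
    \sum_i c i = 0 -> \sum_i c i *: p i = 0 -> forall i, c i = 0.

(* One less than the largest number of affinely independent points of A;
   there are at most d + 1 of them, and adim set0 = -1. *)
Definition adim A : int :=
  (\max_(m < d.+2 | `[< exists p : 'I_m -> 'rV[R]_d,
                          aff_indep p /\ forall i, A (p i) >]) m)%:Z - 1.

(* Taking c = 0 shows that set0 (b = 1) and P itself (b = 0) are faces. *)
Definition is_face P F : Prop :=
  exists (c : 'rV[R]_d) (b : R),
    (forall y, P y -> \sum_j c 0 j * y 0 j <= b) /\
    F = [set y | P y /\ \sum_j c 0 j * y 0 j = b].

(* Nonemptiness matters only when P is a point: set0 is not a facet of it. *)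
Definition is_facet P F : Prop :=
  [/\ is_face P F, F !=set0 & adim F = adim P - 1].

Definition is_vertex P v : Prop := is_face P [set v].

Definition simple_polytope (n : nat) P : Prop :=
  [/\ is_polytope P, adim P = n%:Z
    & forall v, is_vertex P v ->
        ([set F | is_facet P F /\ F v] #= `I_n)%card].

(* Intersecting with P makes the intersection of no facets equal to P. *)
Definition dual_complex P : set (set (set 'rV[R]_d)) :=
  [set S | S `<=` is_facet P /\ (P `&` \bigcap_(F in S) F) !=set0].

End Polytopes.

Definition comb_iso (R : realType) (d1 d2 : nat)
    (P : set 'rV[R]_d1) (Q : set 'rV[R]_d2) : Prop :=
  exists phi : set 'rV[R]_d1 -> set 'rV[R]_d2,
    [/\ set_bij (is_face P) (is_face Q) phi,
        forall F G, is_face P F -> is_face P G ->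
          (F `<=` G <-> phi F `<=` phi G)
      & forall F, is_face P F -> adim (phi F) = adim F].

(* An abstract simplicial complex is given by its set of simplices. *)
Definition complex_vertices (T : Type) (K : set (set T)) : set T :=
  [set v | K [set v]].

Definition complex_iso (T1 T2 : Type) (K1 : set (set T1)) (K2 : set (set T2)) :
    Prop :=
  exists f : T1 -> T2,
    set_bij (complex_vertices K1) (complex_vertices K2) f /\
    forall S, S `<=` complex_vertices K1 -> (K1 S <-> K2 (f @` S)).

(* (i, true) stands for i + 1 and (i, false) for - (i + 1). *)
Definition pm (n : nat) : finType := ('I_n * bool)%type.

Definition antipode (n : nat) (v : pm n) : pm n := (v.1, ~~ v.2).

Section Tubings.
Variables (n : nat) (e : rel (pm n)).
Implicit Types (t u : {set pm n}) (T : set {set pm n}).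

Definition induced t : rel (pm n) :=
  [rel x y | [&& x \in t, y \in t & e x y]].

Definition is_tube t : Prop :=
  [/\ t <> finset.set0,
      forall x y, x \in t -> y \in t -> connect (induced t) x y
    & forall x, x \in t -> antipode x \notin t].

Definition weakly_compatible t u : Prop :=
  [\/ t \subset u, u \subset t
    | [disjoint t & u]%B /\ forall x y, x \in t -> y \in u -> ~~ e x y].

Definition is_tubing T : Prop :=
  [/\ forall t, T t -> is_tube t,
      forall t u, T t -> T u -> weakly_compatible t u
    & forall t u x, T t -> T u -> x \in t -> antipode x \notin u].

Definition is_hypercube_graph_associahedron (R : realType) (d : nat)
    (P : set 'rV[R]_d) : Prop :=
  simple_polytope n P /\ complex_iso (dual_complex P) is_tubing.

End Tubings.

Definition two_complete (n : nat) : rel (pm n) :=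
  [rel x y | (x.2 == y.2) && (x.1 != y.1)].

(* A point is generic when it lies on no reflecting hyperplane x_i = x_j. *)
Definition generic (R : realType) (n : nat) (x : 'rV[R]_n.+1) : Prop :=
  forall i j : 'I_n.+1, i != j -> x 0 i != x 0 j.

Definition permutahedron (R : realType) (n : nat) (x : 'rV[R]_n.+1) :
    set 'rV[R]_n.+1 :=
  conv_hull [set col_perm s x | s in [set: 'S_n.+1]].

(* Main.v *)
(* A polytope's face lattice can be read off its dual complex.  Every nonempty
   face F is the intersection of the facets containing it (facet_separation), and
   a facet G contains the intersection of a simplex S exactly when G can be added
   to every simplex containing S.  So an isomorphism of dual complexes induces an
   isomorphism of face lattices; it preserves dimensions because two nested faces
   are joined by a chain whose dimensions increase by one.  For the permutahedron,
   the facets are indexed by the nonempty proper subsets of the n+1 coordinates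
   and the simplices are the chains of such subsets.  Positive tubes of the 2K_n
   graph are the subsets avoiding the last coordinate, complements of negative
   tubes those containing it, and tubings are chains. *)
Require Import Defs.
From mathcomp Require Import all_boot all_order all_algebra all_fingroup.
From mathcomp Require Import boolp classical_sets functions cardinality reals.
From mathcomp Require Import ring lra zify.

Set Implicit Arguments.
Unset Strict Implicit.
Unset Printing Implicit Defensive.

Import Order.TTheory GRing.Theory Num.Theory.

Local Open Scope classical_set_scope.
Local Open Scope ring_scope.

(** * Affine dimension *)

Section AffineDimension.
Variables (R : realType) (d : nat).
Implicit Types (A B : set 'rV[R]_d) (c y : 'rV[R]_d) (b : R).

Definition dot c y : R := \sum_j c 0 j * y 0 j.

Lemma dotDl c c' y : dot (c + c') y = dot c y + dot c' y.
Proof.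
by rewrite -big_split; apply: eq_bigr => j _; rewrite !mxE mulrDl.
Qed.

Lemma dotZl a c y : dot (a *: c) y = a * dot c y.
Proof. by rewrite mulr_sumr; apply: eq_bigr => j _; rewrite !mxE mulrA. Qed.

Lemma dotNl c y : dot (- c) y = - dot c y.
Proof. by rewrite -scaleN1r dotZl mulN1r. Qed.

Lemma dotZr a c y : dot c (a *: y) = a * dot c y.
Proof. by rewrite mulr_sumr; apply: eq_bigr => j _; rewrite !mxE mulrCA. Qed.

Lemma dot_sumr c m (p : 'I_m -> 'rV[R]_d) :
  dot c (\sum_i p i) = \sum_i dot c (p i).
Proof.
rewrite exchange_big; apply: eq_bigr => j _.
by rewrite summxE mulr_sumr.
Qed.

(* Homogenisation: affine independence and affine functionals become linear. *)
Definition homog y : 'rV[R]_(d + 1) := row_mx y 1%:M.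

Lemma homog_mul_col c b y :
  homog y *m col_mx c^T (- b)%:M = (dot c y - b)%:M.
Proof.
rewrite mul_row_col mul1mx; apply/matrixP => i j.
rewrite !ord1 !mxE !eqxx !mulr1n; congr (_ + _).
by apply: eq_bigr => k _; rewrite !mxE mulrC.
Qed.

(** Lets a linear form on homogenised points be read back as an affine functional. *)
Lemma col_affine (g : 'cV[R]_(d + 1)) :
  exists c b, g = col_mx c^T (- b)%:M.
Proof.
exists (usubmx g)^T, (- dsubmx g 0 0).
by rewrite trmxK opprK -mx11_scalar vsubmxK.
Qed.

Lemma aff_indep_row_free m (p : 'I_m -> 'rV[R]_d) :
  aff_indep p <-> row_free (\matrix_(i < m) homog (p i)).
Proof.
have mulE (u : 'rV[R]_m) : u *m (\matrix_(i < m) homog (p i)) =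
    row_mx (\sum_i u 0 i *: p i) (\sum_i u 0 i)%:M.
  rewrite mulmx_sum_row; apply/rowP => j; rewrite -(fintype.splitK j) summxE.
  case: (fintype.split j) => k /=.
    by rewrite row_mxEl summxE; apply: eq_bigr => i _; rewrite rowK mxE row_mxEl mxE.
  rewrite row_mxEr [k]ord1 mxE mulr1n.
  by apply: eq_bigr => i _; rewrite rowK mxE row_mxEr mxE mulr1.
split=> [ip|fr c c0 cp0 i].
  apply: inj_row_free => u; rewrite mulE -(row_mx0 _ 1 d 1) => /eq_row_mx[up0 u0].
  apply/rowP => i; rewrite mxE; apply: ip up0 i.
  by move/matrixP/(_ 0 0): u0; rewrite !mxE mulr1n.
have /(congr1 (mulmxr (pinvmx (\matrix_(i < m) homog (p i))))) /=:
    (\row_i c i) *m (\matrix_(i < m) homog (p i)) = 0.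
  rewrite mulE -[RHS](row_mx0 _ 1 d 1); congr row_mx.
    by rewrite -[RHS]cp0; apply: eq_bigr => k _; rewrite mxE.
  by rewrite (eq_bigr c) ?c0 ?raddf0 // => k _; rewrite mxE.
rewrite -mulmxA mulmxVp // mulmx1 mul0mx.
by move/rowP/(_ i); rewrite !mxE.
Qed.

(** A largest affinely independent family in [A] has homogenisations spanning those of all of [A],
    since a point outside the span would extend the family. *)
Lemma adim_span A : exists W : 'M[R]_(d + 1),
  [/\ forall y, A y -> (homog y <= W)%MS,
      forall W' : 'M[R]_(d + 1),
        (forall y, A y -> (homog y <= W')%MS) -> (W <= W')%MS
    & adim A = (\rank W)%:Z - 1].
Proof.
pose indep m := exists p : 'I_m -> 'rV[R]_d, aff_indep p /\ forall i, A (p i).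
have [|m0 /asboolP[p [/aff_indep_row_free ip Ap]] maxE] :=
    @eq_bigmax_cond _ [pred m : 'I_d.+2 | `[< indep m >]] (@nat_of_ord _).
  apply/card_gt0P; exists ord0; apply/asboolP.
  have p : 'I_0 -> 'rV[R]_d by case.
  by exists p; split=> [? ? ? []|[]].
set M := \matrix_(i < m0) homog (p i) in ip.
exists <<M>>%MS; split.
- move=> y Ay; rewrite genmxE; apply/negPn/negP => nyM.
  pose q (i : 'I_(m0 + 1)) := match fintype.split i with inl j => p j | inr _ => y end.
  have qM : \matrix_(i < m0 + 1) homog (q i) = col_mx M (homog y).
    apply/row_matrixP => i; rewrite rowK /q -[in RHS](fintype.splitK i).
    case: (fintype.split i) => j /=; first by rewrite rowKu rowK.
    by rewrite rowKd; apply/rowP => k; rewrite [RHS]mxE [j]ord1.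
  have fq : row_free (col_mx M (homog y)).
    rewrite /row_free eqn_leq rank_leq_row -addsmxE addn1 /=.
    suff : (\rank M < \rank (M + homog y))%N by rewrite (eqP ip).
    apply: rank_ltmx; rewrite /ltmx addsmxSl /=; apply: contra nyM => le.
    exact: submx_trans (addsmxSr _ _) le.
  (* The extended family still falls in the range of the maximum, because independent rows number at
     most d + 1. *)
  have ltd : (m0.+1 < d.+2)%N.
    by have := rank_leq_col (col_mx M (homog y)); rewrite (eqP fq) !addn1 ltnS.
  have : (Ordinal ltd <= \max_(m in [pred m : 'I_d.+2 | `[< indep m >]]) m)%N.
    apply: (@leq_bigmax_cond _ _ (@nat_of_ord _)); rewrite inE; do 2!apply/asboolP.
    suff : indep (m0 + 1)%N by rewrite addn1.
    exists q; split=> [|i]; first by apply/aff_indep_row_free; rewrite qM.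
    by rewrite /q; case: (fintype.split i).
  by rewrite maxE ltnn.
- move=> W' AW'; rewrite genmxE; apply/row_subP => i; rewrite rowK.
  exact: AW'.
- by rewrite mxrank_gen (eqP ip) -maxE.
Qed.

(** A row space is cut out by its linear equations, and on homogenised points these are affine
    equations. Hence the span of [B] lies in that of [A]. This is the tool for all lower bounds on
    dimensions. *)
Lemma adim_le A B :
  (forall c b, (forall y, A y -> dot c y = b) ->
     forall y, B y -> dot c y = b) ->
  adim B <= adim A.
Proof.
move=> AB; have [U [AU _ ->]] := adim_span A.
have [W [_ leW ->]] := adim_span B.
rewrite lerD2r lez_nat; apply/mxrankS/leW => y By.
rewrite submxE; apply/eqP/rowP => j; rewrite [RHS]mxE.
(* Each column of the cokernel of [U] is an affine functional vanishing on [A]. *)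
have [c [b gE]] := col_affine (col j (cokermx U)).
have entryE z : (homog z *m cokermx U) 0 j = dot c z - b.
  have /matrixP/(_ 0 0) := homog_mul_col c b z.
  by rewrite -gE colE mulmxA -colE mxE [RHS]mxE mulr1n.
rewrite entryE (AB c b) ?subrr // => z /AU; rewrite submxE => /eqP/rowP/(_ j).
by rewrite entryE mxE => /subr0_eq.
Qed.

Lemma adimS A B : A `<=` B -> adim A <= adim B.
Proof. by move=> AB; apply: adim_le => c b Bc y /AB; apply: Bc. Qed.

(** The functional kills the span of [A] but not [homog z], so the inclusion of spans is strict. *)
Lemma adim_lt A B c b z : A `<=` B -> (forall y, A y -> dot c y = b) ->
  B z -> dot c z != b -> adim A < adim B.
Proof.
move=> AB Ac Bz czb; have [U [AU leU ->]] := adim_span A.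
have [W [BW leW ->]] := adim_span B.
rewrite ltrD2r ltz_nat; apply: rank_ltmx; rewrite /ltmx; apply/andP; split.
  by apply: leU => y /AB; apply: BW.
apply: contra czb => leWU.
have /(submx_trans (submx_trans (BW z Bz) leWU)) :
    (U <= kermx (col_mx c^T (- b)%:M))%MS.
  by apply: leU => y /Ac cy; apply/sub_kermxP; rewrite homog_mul_col cy subrr raddf0.
move/sub_kermxP; rewrite homog_mul_col => /matrixP/(_ 0 0).
by rewrite !mxE mulr1n => /subr0_eq ->.
Qed.

Lemma adimU1 A z : adim (A `|` [set z]) <= adim A + 1.
Proof.
have [U [AU leU ->]] := adim_span A.
have [W [BW leW ->]] := adim_span (A `|` [set z]).
rewrite subrK lerBlDr lez_nat.
apply: leq_trans (mxrankS (leW (U + homog z)%MS _)) _.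
  move=> y [/AU yU|->]; last exact: addsmxSr.
  exact: submx_trans yU (addsmxSl _ _).
by apply: leq_trans (mxrank_adds_leqif _ _) _; rewrite leq_add2l rank_leq_row.
Qed.

Lemma adim_set0 : adim (@set0 'rV[R]_d) = -1.
Proof.
have [W [_ leW ->]] := adim_span set0.
by have /(_ _) := leW 0 _; rewrite submx0 => /(_ _)/eqP-> //; rewrite mxrank0.
Qed.

(** An affine functional vanishing everywhere is zero, by evaluation at the origin and at the unit
    vectors, so the span has zero cokernel. *)
Lemma adim_setT : adim [set: 'rV[R]_d] = d%:Z.
Proof.
have [W [WT _ ->]] := adim_span [set: 'rV[R]_d].
suff /eqP-> : row_full W by rewrite PoszD addrK.
rewrite -sub1mx submxE mul1mx; apply/eqP/matrixP => i j; rewrite [RHS]mxE.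
have [c [b gE]] := col_affine (col j (cokermx W)).
have cb y : dot c y = b.
  have /matrixP/(_ 0 0) := homog_mul_col c b y.
  rewrite -gE colE mulmxA; have := WT y I; rewrite submxE => /eqP->.
  by rewrite mul0mx !mxE mulr1n => /esym/subr0_eq.
have b0 : b = 0 by rewrite -(cb 0) -(scale0r 0) dotZr mul0r.
have c0 : c = 0.
  apply/rowP => k; rewrite mxE -b0 -(cb (delta_mx 0 k)) /dot (bigD1 k) //=.
  rewrite big1 ?addr0 => [|l lk]; first by rewrite mxE !eqxx mulr1.
  by rewrite mxE (negPf lk) andbF mulr0.
have /colP/(_ i) := gE; rewrite mxE => ->.
by rewrite c0 b0 trmx0 oppr0 raddf0 col_mx0 mxE.
Qed.

End AffineDimension.

(** * Faces of polytopes *)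

Lemma count_lt (T : eqType) (p q : pred T) (s : seq T) x :
  subpred p q -> x \in s -> q x -> ~~ p x -> (count p s < count q s)%N.
Proof.
move=> pq + qx npx; elim: s => //= y s IH; rewrite inE => /orP[/eqP<-|/IH lt].
  by rewrite qx (negPf npx) ltnS sub_count.
rewrite -addnS leq_add //; have /implyP := pq y.
by case: (p y); case: (q y).
Qed.

(** Supplies the large multiple used in [face_trans]; it exists because finitely many ratios are
    bounded. *)
Lemma exists_scale (R : realType) (T : eqType) (s : seq T) (f g : T -> R) :
  exists N : R, 0 <= N /\ forall v, v \in s -> 0 < f v -> g v < N * f v.
Proof.
elim: s => [|a s [N [N0 IH]]]; first by exists 0.
exists (Num.max N (g a / f a + 1)); split; first by rewrite le_max N0.
move=> v; rewrite inE => /orP[/eqP->|vs] fv.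
  apply: (@lt_le_trans _ _ ((g a / f a + 1) * f a)); last first.
    by apply: ler_wpM2r; rewrite ?le_max ?lexx ?orbT// ltW.
  by rewrite mulrDl mul1r divfK ?gt_eqF // ltrDl.
apply: lt_le_trans (IH v vs fv) _.
by apply: ler_wpM2r; rewrite ?le_max ?lexx// ltW.
Qed.

Lemma seq_argmin (R : realType) (T : eqType) (s : seq T) (p : pred T) (f : T -> R) :
  has p s -> exists2 v, v \in s & p v /\ forall w, w \in s -> p w -> f v <= f w.
Proof.
elim: s => //= a s IH /orP[pa|/IH[v vs [pv vmin]]]; last first.
  have [pa|npa] := boolP (p a); last first.
    exists v; first by rewrite inE vs orbT.
    split=> // w; rewrite inE => /orP[/eqP-> pa|]; last exact: vmin.
    by rewrite pa in npa.
  have [fav|fva] := leP (f a) (f v).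
    exists a; first by rewrite mem_head.
    split=> // w; rewrite inE => /orP[/eqP->//|ws pw].
    exact: le_trans fav (vmin w ws pw).
  exists v; first by rewrite inE vs orbT.
  split=> // w; rewrite inE => /orP[/eqP->_|]; [exact: ltW|exact: vmin].
have [/IH[v vs [pv vmin]]|nps] := boolP (has p s).
  have [fav|fva] := leP (f a) (f v).
    exists a; first by rewrite mem_head.
    split=> // w; rewrite inE => /orP[/eqP->//|ws pw].
    exact: le_trans fav (vmin w ws pw).
  exists v; first by rewrite inE vs orbT.
  split=> // w; rewrite inE => /orP[/eqP->_|]; [exact: ltW|exact: vmin].
exists a; first by rewrite mem_head.
split=> // w; rewrite inE => /orP[/eqP->//|ws pw].
by case/hasP: nps; exists w.
Qed.


Section Faces.
Variables (R : realType) (d : nat).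
Implicit Types (A P F G H : set 'rV[R]_d) (V : seq 'rV[R]_d).
Implicit Types (c v y : 'rV[R]_d) (b : R) (S : set (set 'rV[R]_d)).

Lemma dot_comb c m (p : 'I_m -> 'rV[R]_d) (w : 'I_m -> R) :
  dot c (\sum_i w i *: p i) = \sum_i w i * dot c (p i).
Proof. by rewrite dot_sumr; apply: eq_bigr => i _; rewrite dotZr. Qed.

Lemma sub_conv_hull A : A `<=` conv_hull A.
Proof.
move=> y Ay; exists 1, (fun=> y), (fun=> 1).
by split=> //; rewrite big_ord1 ?scale1r.
Qed.

Lemma conv_hullS A B : A `<=` B -> conv_hull A `<=` conv_hull B.
Proof. by move=> AB y [m [p [w [Ap w0 w1 ->]]]]; exists m, p, w; split; auto. Qed.

Lemma conv_hull_neq0 A y : conv_hull A y -> A !=set0.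
Proof.
move=> [[|m] [p [w [Ap _ w1 _]]]]; last by exists (p ord0).
by move: w1; rewrite big_ord0 => /esym/eqP; rewrite oner_eq0.
Qed.

Lemma conv_hull_le A c b : (forall y, A y -> dot c y <= b) ->
  forall y, conv_hull A y -> dot c y <= b.
Proof.
move=> cb _ [m [p [w [Ap w0 w1 ->]]]].
rewrite dot_comb -[leRHS]mul1r -w1 mulr_suml.
by apply: ler_sum => i _; apply: ler_wpM2l; auto.
Qed.

Lemma conv_hull_eq A c b : (forall y, A y -> dot c y = b) ->
  forall y, conv_hull A y -> dot c y = b.
Proof.
move=> cb _ [m [p [w [Ap w0 w1 ->]]]].
rewrite dot_comb -[RHS]mul1r -w1 mulr_suml.
by apply: eq_bigr => i _; rewrite cb.
Qed.

(** The weighted slacks are nonnegative and sum to zero, so every point of nonzero weight attains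
    the bound. *)
Lemma conv_hull_face A c b y : (forall z, A z -> dot c z <= b) ->
  conv_hull A y -> dot c y = b -> conv_hull [set z | A z /\ dot c z = b] y.
Proof.
move=> cb [m [p [w [Ap w0 w1 ->]]]]; rewrite dot_comb => E.
have slack i : w i = 0 \/ dot c (p i) = b.
  have s0 : \sum_i w i * (b - dot c (p i)) = 0.
    under eq_bigr do rewrite mulrBr.
    by rewrite sumrB -mulr_suml w1 mul1r E subrr.
  have /psumr_eq0P/(_ s0)/(_ i isT)/eqP : forall i, true ->
      0 <= w i * (b - dot c (p i)).
    by move=> k _; rewrite mulr_ge0 ?subr_ge0 ?cb.
  by rewrite mulf_eq0 => /orP[/eqP|]; [left|rewrite subr_eq0 => /eqP; right].
have [i0 wi0] : exists i0, w i0 != 0.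
  apply/not_existsP => w'0; have /eqP := w1; rewrite big1 ?eqr01 //.
    by rewrite eq_sym oner_eq0.
  by move=> i _; apply/eqP; move: (w'0 i) => /negP; rewrite negbK.
(* Points of weight zero may lie off the face; replacing them by [p i0] leaves the combination
   unchanged. *)
exists m, (fun i => if w i == 0 then p i0 else p i), w; split => //.
  move=> i; case: ifPn => [_|wi]; split=> //.
    by have [/eqP|//] := slack i0; rewrite (negPf wi0).
  by have [/eqP|//] := slack i; rewrite (negPf wi).
by apply: eq_bigr => i _; case: eqP => // ->; rewrite !scale0r.
Qed.

Lemma faceE V c b : (forall v, v \in V -> dot c v <= b) ->
  [set y | conv_hull [set` V] y /\ dot c y = b]
    = conv_hull [set` [seq v <- V | dot c v == b]].
Proof.
move=> cb; apply/seteqP; split=> y.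
  move=> [Vy cy]; have := conv_hull_face cb Vy cy; apply: conv_hullS.
  by move=> v [/= vV /eqP cv]; rewrite mem_filter cv.
move=> Fy; split.
  by apply: conv_hullS Fy => v /=; rewrite mem_filter => /andP[].
by apply: conv_hull_eq Fy => v /=; rewrite mem_filter => /andP[/eqP].
Qed.

Lemma face_polytope P F : is_polytope P -> is_face P F -> is_polytope F.
Proof.
move=> [V ->] [c [b [cb ->]]].
exists [seq v <- V | dot c v == b]; rewrite -faceE // => v Vv.
exact/cb/sub_conv_hull.
Qed.

Lemma face_sub P F : is_face P F -> F `<=` P.
Proof. by move=> [c [b [_ ->]]] y []. Qed.

Lemma face_refl P : is_face P P.
Proof.
exists 0, 0; have c0 y : dot 0 y = 0 :> R.
  by rewrite /dot big1 // => j _; rewrite mxE mul0r.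
split=> [y _|]; first by rewrite [X in X <= _]c0.
by apply/seteqP; split=> y => [Py|[]//]; split=> //; apply: c0.
Qed.

Lemma face_set0 P : is_face P set0.
Proof.
exists 0, 1; have c0 y : dot 0 y = 0 :> R.
  by rewrite /dot big1 // => j _; rewrite mxE mul0r.
split=> [y _|]; first by rewrite [X in X <= _]c0.
apply/esym; rewrite -subset0 => y [_]; rewrite [X in X = _]c0 => /eqP.
by rewrite eq_sym oner_eq0.
Qed.

(** The sum of two valid inequalities is tight exactly where both are. *)
Lemma face_cap P F G : is_face P F -> is_face P G -> is_face P (F `&` G).
Proof.
move=> [c [b [cb ->]]] [c' [b' [cb' ->]]]; exists (c + c'), (b + b'); split.
  by move=> y Py; rewrite [X in X <= _]dotDl lerD ?cb ?cb'.
apply/seteqP; split=> y /=.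
  by move=> [[Py E] [_ E']]; split=> //; rewrite [LHS]dotDl; congr (_ + _).
move=> [Py]; rewrite [X in X = _]dotDl.
have := cb y Py; have := cb' y Py; rewrite -!/(dot _ _) => *.
by do !split=> //; lra.
Qed.

Lemma face_of_sub P F G : is_face P F -> is_face P G -> F `<=` G -> is_face G F.
Proof.
move=> [c [b [cb ->]]] /face_sub GP FG; exists c, b; split.
  by move=> y /GP; apply: cb.
apply/seteqP; split=> y; last by move=> [/GP Py cy].
by move=> [Py cy]; split=> //; apply: FG.
Qed.

(* The functional exposing G in F need not be valid on P, but it becomes so
   after adding a large multiple of the one exposing F. *)
Lemma face_trans P F G :
  is_polytope P -> is_face P F -> is_face F G -> is_face P G.
Proof.
move=> [V ->] [c [b [cb ->]]] [c' [b' [cb' ->]]].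
have {}cb v : v \in V -> dot c v <= b by move=> vV; exact/cb/sub_conv_hull.
have {}cb' v : v \in V -> dot c v = b -> dot c' v <= b'.
  by move=> vV cv; apply: cb'; split=> //; apply: sub_conv_hull.
have [N [N0 HN]] :=
  exists_scale V (fun v => b - dot c v) (fun v => dot c' v - b').
have dE y : dot (N *: c + c') y = N * dot c y + dot c' y.
  by rewrite dotDl dotZl.
have val v : v \in V -> dot (N *: c + c') v <= N * b + b' /\
    (dot (N *: c + c') v = N * b + b' -> dot c v = b).
  move=> vV; rewrite dE; have := cb v vV; rewrite le_eqVlt => /orP[/eqP E|lt].
    by rewrite E lerD2l cb'.
  have := HN v vV; rewrite subr_gt0 mulrBr => /(_ lt) ?.
  by split; lra.
exists (N *: c + c'), (N * b + b'); split.
  by apply: conv_hull_le => v /= /val[].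
apply/seteqP; split=> y /=.
  move=> [[Vy cy] cy']; split=> //; rewrite [LHS]dE.
  by move: cy cy'; rewrite -!/(dot _ _) => -> ->.
move=> [Vy E]; have vl v : v \in V -> dot (N *: c + c') v <= N * b + b'.
  by move=> /val[].
have cy : dot c y = b.
  apply: conv_hull_eq (conv_hull_face vl Vy E) => v [/val[_]] /[apply].
  by [].
split; first by split.
move: E; rewrite -!/(dot _ _) dE cy; exact: addrI.
Qed.

Lemma face_lt_adim P F : is_face P F -> F <> P -> adim F < adim P.
Proof.
move=> PF FP; have FsP := face_sub PF; move: PF => [c [b [_ FE]]].
have [z [Pz Fz]] : exists z, P z /\ ~ F z.
  apply/not_existsP => H; apply: FP; apply/seteqP; split=> // z Pz.
  by apply: contrapT => nFz; apply: (H z).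
apply: (@adim_lt _ _ F P c b z) => //; first by move=> y; rewrite FE => -[].
by apply/eqP => E; apply: Fz; rewrite FE.
Qed.

(** [S] may be infinite, but each of the finitely many generators outside the intersection is
    already excluded by one member of [S]. A finite intersection thus has the same generators, and a
    face is the hull of its generators. *)
Lemma face_bigcap P S : is_polytope P -> S `<=` is_face P ->
  is_face P (P `&` \bigcap_(F in S) F).
Proof.
move=> pP SP; have [V PE] := pP.
have [F [PF IF FI]] : exists F, [/\ is_face P F, P `&` \bigcap_(F in S) F `<=` F &
    forall v, v \in V -> F v -> (P `&` \bigcap_(F in S) F) v].
  have : {subset V <= V} by [].
  elim: {-2}V => [_|v W IH WV].
    by exists P; split; [exact: face_refl|move=> y []|].
  have [|F [PF IF FI]] := IH; first by move=> w wW; rewrite WV // inE wW orbT.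
  have Pv : P v by rewrite PE; apply/sub_conv_hull; rewrite /= WV // mem_head.
  have [Iv|nIv] := pselect ((P `&` \bigcap_(F in S) F) v).
    by exists F; split=> // w; rewrite inE => /orP[/eqP->|/FI].
  have [G [SG nGv]] : exists G, S G /\ ~ G v.
    apply/not_existsP => H; apply: nIv; split=> // G SG.
    by apply: contrapT => nGv; apply: (H G).
  exists (F `&` G); split; first exact: face_cap PF (SP _ SG).
    by move=> y Iy; split; [exact: IF|case: Iy => _; exact].
  by move=> w; rewrite inE => /orP[/eqP-> [//]|wW [Fw _]]; exact: FI.
suff -> : P `&` \bigcap_(F in S) F = F by [].
apply/seteqP; split=> //; have [c [b [cb FE]]] := PF.
have E : F = conv_hull [set` [seq v <- V | dot c v == b]].
  by rewrite FE {1}PE faceE // => v vV; apply: cb; rewrite PE; exact: sub_conv_hull.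
have filterF v : v \in [seq v <- V | dot c v == b] -> (P `&` \bigcap_(F in S) F) v.
  move=> vf; apply: FI; first by move: vf; rewrite mem_filter => /andP[].
  by rewrite E; apply: sub_conv_hull.
move=> y Fy; split; first exact: face_sub PF _ Fy.
move=> G SG; have [c' [b' [cb' GE]]] := SP G SG; rewrite GE.
split; first exact: face_sub PF _ Fy.
move: Fy; rewrite E; apply: conv_hull_eq => v /filterF[_ /(_ G SG)].
by rewrite GE => -[].
Qed.

(* If H is not yet a facet, some affine functional g vanishes on H and at y but
   not on P; subtracting from the slack of H the largest admissible multiple of
   g tilts H to a strictly larger face that still avoids y. *)
Lemma facet_separation P F y : is_polytope P -> is_face P F -> F !=set0 ->
  P y -> ~ F y -> exists G, [/\ is_facet P G, F `<=` G & ~ G y].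
Proof.
move=> [V PE] PF F0 Py; rewrite {1}PE in Py.
have VP v : v \in V -> P v by move=> vV; rewrite PE; exact: sub_conv_hull.
(* The induction is on the number of generators outside [F], which drops with each tilt. *)
have [k] := ubnP (count (fun v => ~~ `[< F v >]) V).
elim: k F PF F0 => // k IH F PF F0 countF nFy.
have Py' : P y by rewrite PE.
have [facetF|nfF] := pselect (is_facet P F); first by exists F; split.
have ltF : adim F < adim P.
  by apply: face_lt_adim => // E; apply: nFy; rewrite E.
(* Not being a facet, [F] has dimension at most [adim P - 2], which leaves room for one more
   point. *)
have ltFy : adim (F `|` [set y]) < adim P.
  apply: le_lt_trans (adimU1 F y) _; rewrite lt_neqAle; apply/andP; split.
    by apply/eqP => E; apply: nfF; split=> //; rewrite -E addrK.
    lia.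
(* If every affine equation valid on [F] and at [y] held at all generators, [adim_le] would
   contradict the strict inequality of dimensions. *)
have [g [a [ga [v0 [v0V gv0]]]]] : exists g a,
    (forall z, (F `|` [set y]) z -> dot g z = a) /\
    exists v, v \in V /\ dot g v <> a.
  apply: contrapT => H; move: ltFy; rewrite ltNge => /negP; apply.
  apply: adim_le => c b cb z; rewrite PE; apply: conv_hull_eq => v vV.
  by apply: contrapT => cv; apply: H; exists c, b; split=> //; exists v.
wlog {gv0} gv0 : g a ga / a < dot g v0.
  move=> wl; have : dot g v0 != a by apply/eqP.
  rewrite neq_lt => /orP[lt|]; last exact: wl.
  apply: (wl (- g) (- a)); last by rewrite dotNl ltrN2.
  by move=> z /ga; rewrite dotNl => ->.
have [c [b [cb FE]]] := PF.
have {}cb v : P v -> dot c v <= b := cb v.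
(* A ratio test as in the simplex method: only generators with [dot g v] above [a] bound the
   multiple of [g], and the smallest ratio is the binding one. *)
pose t v := (b - dot c v) / (dot g v - a).
have [|v1 v1V [gv1 tmin]] := @seq_argmin R _ V (fun v => a < dot g v) t.
  by apply/hasP; exists v0.
have t0 : 0 <= t v1.
  by apply: divr_ge0; rewrite subr_ge0; [exact/cb/VP|exact: ltW].
pose c' := c + t v1 *: g; pose b' := b + t v1 * a.
have c'E z : dot c' z = dot c z + t v1 * dot g z by rewrite dotDl dotZl.
have cb' v : v \in V -> dot c' v <= b'.
  move=> vV; rewrite c'E /b'; have [ltg|leg] := ltP a (dot g v).
    have := tmin v vV ltg; rewrite {2}/t ler_pdivlMr ?subr_gt0 // => ?; nra.
  have := cb v (VP v vV) => ?; nra.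
have c'v1 : dot c' v1 = b'.
  have : t v1 * (dot g v1 - a) = b - dot c v1.
    by rewrite divfK // subr_eq0 gt_eqF.
  by rewrite c'E /b' => ?; lra.
have nFv1 : ~ F v1.
  by move=> Fv1; move: gv1; rewrite ga ?ltxx //; left.
pose F' := [set z | P z /\ dot c' z = b'].
have FF' : F `<=` F'.
  move=> z Fz; split; first exact: face_sub PF _ Fz.
  rewrite c'E ga; last by left.
  by move: Fz; rewrite FE => -[_]; rewrite -/(dot c z) => ->.
have [] := IH F'.
- exists c', b'; split=> //; rewrite PE; exact: conv_hull_le.
- by case: F0 => z /FF'; exists z.
- rewrite ltnS in countF; apply: leq_trans countF; apply: (@count_lt _ _ _ _ v1) => //.
  + move=> z /=; apply: contra => /asboolP/FF'?; exact/asboolP.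
  + by apply/negP => /asboolP.
  + by rewrite negbK; apply/asboolP; split=> //; exact: VP.
- move=> [_]; rewrite c'E (ga y); last by right.
  move=> /addIr cy; apply: nFy; rewrite FE; split=> //.
move=> G [PG F'G nGy]; exists G; split=> //.
exact: subset_trans FF' F'G.
Qed.

End Faces.

(** * Dual complex and face lattice *)

Section ComplexIso.
Variables (T1 T2 T3 : Type).
Variables (K1 : set (set T1)) (K2 : set (set T2)) (K3 : set (set T3)).

Lemma complex_iso_inv (x0 : T1) : complex_iso K1 K2 ->
  exists f g,
    [/\ forall v, complex_vertices K1 v -> complex_vertices K2 (f v) /\ g (f v) = v,
        forall w, complex_vertices K2 w -> complex_vertices K1 (g w) /\ f (g w) = w,
        forall S, S `<=` complex_vertices K1 -> (K1 S <-> K2 (f @` S))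
      & forall S, S `<=` complex_vertices K2 -> (K2 S <-> K1 (g @` S))].
Proof.
move=> [f [[ff fI fS] fK]].
have /choice[g gP] : forall w, exists v, complex_vertices K2 w ->
    complex_vertices K1 v /\ f v = w.
  move=> w; have [/fS[v Kv fv]|nw] := pselect (complex_vertices K2 w).
    by exists v.
  (* A default value: only the values of [g] on vertices matter. *)
  by exists x0.
exists f, g; split=> //.
  move=> v Kv; split; first exact: ff.
  by have [? E] := gP _ (ff v Kv); apply: fI; rewrite ?inE.
move=> S S2; have gS1 : g @` S `<=` complex_vertices K1.
  by move=> _ [w /S2/gP[? _] <-].
rewrite (fK _ gS1); suff -> : f @` (g @` S) = S by [].
apply/seteqP; split=> w; first by move=> [_ [u Su <-] <-]; have [_ ->] := gP u (S2 u Su).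
by move=> Sw; exists (g w); [exists w|have [] := gP w (S2 w Sw)].
Qed.

Lemma complex_iso_sym (x0 : T1) : complex_iso K1 K2 -> complex_iso K2 K1.
Proof.
move=> /(complex_iso_inv x0)[f [g [fP gP _ gK]]]; exists g; split=> //.
split.
- by move=> w /gP[].
- move=> w u; rewrite !inE => /gP[_ Ew] /gP[_ Eu] E.
  by rewrite -Ew E.
- by move=> v /fP[? E]; exists (f v).
Qed.

Lemma complex_iso_trans :
  complex_iso K1 K2 -> complex_iso K2 K3 -> complex_iso K1 K3.
Proof.
move=> [f [[ff fI fS] fK]] [g [[gf gI gS] gK]]; exists (g \o f); split.
  split.
  - by move=> v /ff; apply: gf.
  - move=> u v Ku Kv /gI E; apply: fI => //; apply: E; rewrite inE; apply: ff.
      by rewrite inE in Ku.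
    by rewrite inE in Kv.
  - by move=> w /gS[v /fS[u Ku <-] <-]; exists u.
move=> S S1; rewrite fK // gK; first by rewrite image_comp.
by move=> _ [v /S1/ff Kv <-].
Qed.

End ComplexIso.

(** * Faces as meets of facets *)

Section DualComplex.
Variables (R : realType) (d : nat).
Implicit Types (P F G : set 'rV[R]_d) (S : set (set 'rV[R]_d)).

Definition meet_in P S := P `&` \bigcap_(G in S) G.

Definition facets_above P F := [set G | is_facet P G /\ F `<=` G].

Lemma facet_face P F : is_facet P F -> is_face P F.
Proof. by case. Qed.

Lemma dual_vertices P : complex_vertices (dual_complex P) = is_facet P.
Proof.
apply/seteqP; split=> F; first by move=> [/(_ F erefl)].
move=> fF; split; first by move=> _ ->.
by case: (fF) => FP [y Fy] _; exists y; split; [apply: face_sub FP _ _|move=> _ ->].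
Qed.

Lemma meet_in_face P S : is_polytope P -> S `<=` is_facet P ->
  is_face P (meet_in P S).
Proof. by move=> pP SP; apply: face_bigcap => // G /SP/facet_face. Qed.

Lemma facets_above_dual P F : is_face P F -> F !=set0 ->
  dual_complex P (facets_above P F).
Proof.
move=> PF [y Fy]; split=> [G []//|]; exists y; split; first exact: face_sub PF _ _.
by move=> G [_]; apply.
Qed.

Lemma meet_facets_above P F : is_polytope P -> is_face P F -> F !=set0 ->
  meet_in P (facets_above P F) = F.
Proof.
move=> pP PF F0; apply/seteqP; split=> y.
  move=> [Py IFy]; apply: contrapT => nFy.
  have [G [PG FG nGy]] := facet_separation pP PF F0 Py nFy.
  by apply: nGy; apply: IFy.
by move=> Fy; split; [exact: face_sub PF _ Fy|move=> G [_]; apply].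
Qed.

(* If the face F cut out by S is not inside G, then minimising the functional
   of G over F yields a face of F disjoint from G. *)
Lemma meet_in_subP P S G : is_polytope P -> dual_complex P S -> is_facet P G ->
  meet_in P S `<=` G <->
  forall T, dual_complex P T -> S `<=` T -> dual_complex P (G |` T).
Proof.
move=> pP [SP S0] PG; split.
  move=> SG T [TP [y [Py Ty]]] ST; split; first by move=> ? [->|/TP].
  exists y; split=> // ? [->|/Ty//]; apply: SG; split=> // H /ST; exact: Ty.
move=> H; apply: contrapT => nSG.
have PF := meet_in_face pP SP; set F := meet_in P S in nSG PF.
have [y [Fy nGy]] : exists y, F y /\ ~ G y.
  apply/not_existsP => H'; apply: nSG => y Fy.
  by apply: contrapT => nGy; apply: (H' y).
have [c [b [cb GE]]] := facet_face PG.
have [V FE] := face_polytope pP PF.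
have VF v : v \in V -> F v by move=> vV; rewrite FE; exact: sub_conv_hull.
have [|m mV [_ mmin]] := @seq_argmin R _ V xpredT (dot c).
  by move: Fy; rewrite FE => /conv_hull_neq0[v vV]; apply/hasP; exists v.
have mF z : F z -> dot c m <= dot c z.
  rewrite FE => Fz; rewrite -lerN2 -!dotNl; move: z Fz; apply: conv_hull_le => v vV.
  by rewrite !dotNl lerN2; exact: mmin.
have mb : dot c m < b.
  apply: le_lt_trans (mF y Fy) _; rewrite lt_neqAle; apply/andP; split.
    by apply/eqP => E; apply: nGy; rewrite GE; split=> //; exact: face_sub PF _ Fy.
  by apply: cb; exact: face_sub PF _ Fy.
pose F' := [set z | F z /\ dot (- c) z = - dot c m].
have PF' : is_face P F'.
  apply: face_trans PF _ => //; exists (- c), (- dot c m); split=> // z Fz.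
  by rewrite [leLHS]dotNl lerN2; exact: mF.
have F'0 : F' !=set0.
  by exists m; split; [exact: VF|rewrite dotNl].
(* The facets through [F'] form a simplex containing [S]. Adding [G] to it yields a point of [F'] on
   [G], although [c] takes the value [dot c m], below [b], on [F']. *)
have [|_ [z Iz]] := H (facets_above P F') (facets_above_dual PF' F'0).
  move=> K SK; split; first exact: SP.
  by move=> z [[_ Iz] _]; exact: Iz.
have : meet_in P (facets_above P F') z.
  by case: Iz => Pz Iz; split=> // K FK; apply: Iz; right.
rewrite meet_facets_above // => -[_]; rewrite dotNl => /oppr_inj czm.
have : G z by case: Iz => _; apply; left.
by rewrite GE => -[_]; rewrite -/(dot c z) czm => /eqP; rewrite lt_eqF.
Qed.

End DualComplex.

(** * From isomorphic dual complexes to isomorphic face lattices *)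

Section CombIso.
Variables (R : realType).

(** One half of an isomorphism of dual complexes; assuming it in both directions makes [f] and [g]
    mutually inverse on facets. *)
Definition dual_map d1 d2 (P : set 'rV[R]_d1) (Q : set 'rV[R]_d2) f g : Prop :=
  (forall F, is_facet P F -> is_facet Q (f F) /\ g (f F) = F) /\
  (forall S, S `<=` is_facet P -> (dual_complex P S <-> dual_complex Q (f @` S))).

(** The guard sends the empty face to the empty face. When [P] is a point there are no facets, and
    the meet alone would give all of [Q]. *)
Definition face_map d1 d2 (P : set 'rV[R]_d1) (Q : set 'rV[R]_d2)
    (f : set 'rV[R]_d1 -> set 'rV[R]_d2) (F : set 'rV[R]_d1) : set 'rV[R]_d2 :=
  [set y | F !=set0 /\ meet_in Q (f @` facets_above P F) y].

Lemma image_inv d1 d2 (P : set 'rV[R]_d1) (Q : set 'rV[R]_d2) f g S :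
  dual_map P Q f g -> S `<=` is_facet P -> g @` (f @` S) = S.
Proof.
move=> [fP _] SP; apply/seteqP; split=> F.
  by move=> [_ [G SG <-] <-]; have [_ ->] := fP G (SP G SG).
by move=> SF; exists (f F); [exists F|have [] := fP F (SP F SF)].
Qed.

Lemma dual_map_sub d1 d2 (P : set 'rV[R]_d1) (Q : set 'rV[R]_d2) f g S G :
  is_polytope P -> is_polytope Q -> dual_map P Q f g -> dual_map Q P g f ->
  dual_complex P S -> is_facet P G ->
  meet_in P S `<=` G -> meet_in Q (f @` S) `<=` f G.
Proof.
move=> pP pQ iPQ iQP KS PG /(meet_in_subP pP KS PG) H.
have [fP fK] := iPQ; have [gQ gK] := iQP.
have SP : S `<=` is_facet P by case: KS.
apply/meet_in_subP => //; [by rewrite -fK|by have [] := fP G PG|].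
move=> T KT ST; have TQ : T `<=` is_facet Q by case: KT.
have KgT : dual_complex P (g @` T) by rewrite -gK.
have : dual_complex P (G |` g @` T).
  apply: H => //; rewrite -(image_inv iPQ SP); exact: image_subset.
have [gTP _] := KgT.
rewrite fK; last by move=> ? [->|/gTP].
by rewrite image_setU image_set1 (image_inv iQP).
Qed.

Section FaceMap.
Variables (d1 d2 : nat) (P : set 'rV[R]_d1) (Q : set 'rV[R]_d2).
Variables (f : set 'rV[R]_d1 -> set 'rV[R]_d2) (g : set 'rV[R]_d2 -> set 'rV[R]_d1).
Hypotheses (pP : is_polytope P) (pQ : is_polytope Q).
Hypotheses (iPQ : dual_map P Q f g) (iQP : dual_map Q P g f).
Local Notation phi := (face_map P Q f).
Local Notation psi := (face_map Q P g).

Lemma face_map0 : phi set0 = set0.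
Proof. by rewrite -subset0 => y [[]]. Qed.

Lemma face_map_meet F : F !=set0 -> phi F = meet_in Q (f @` facets_above P F).
Proof. by move=> F0; apply/seteqP; split=> y //; case. Qed.

Lemma image_facets_above F : f @` facets_above P F `<=` is_facet Q.
Proof. by move=> _ [G [PG _] <-]; have [fP _] := iPQ; have [] := fP G PG. Qed.

Lemma face_map_face F : is_face P F -> is_face Q (phi F).
Proof.
have [->|/set0P F0] := eqVneq F set0; first by rewrite face_map0 => _; exact: face_set0.
by move=> PF; rewrite face_map_meet //; apply: meet_in_face => //; exact: image_facets_above.
Qed.

Lemma face_map_neq0 F : is_face P F -> F !=set0 -> phi F !=set0.
Proof.
move=> PF F0; rewrite face_map_meet //; have [_ fK] := iPQ.
have K := facets_above_dual PF F0.
by have /(fK _ (proj1 K))[] := K.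
Qed.

(** [dual_map_sub] for [f] gives one inclusion and for [g] the other. Since a nonempty face is the
    meet of the facets above it, this makes the two face maps inverse to each other. *)
Lemma face_map_above F : is_face P F -> F !=set0 ->
  facets_above Q (phi F) = f @` facets_above P F.
Proof.
move=> PF F0; have K := facets_above_dual PF F0.
have [fP fK] := iPQ; have [gQ gK] := iQP.
rewrite face_map_meet //; apply/seteqP; split=> H.
  move=> [QH SH]; exists (g H); last by have [] := gQ H QH.
  have [PgH fgH] := gQ H QH.
  split=> //; have := dual_map_sub pQ pP iQP iPQ _ QH SH.
  rewrite (image_inv iPQ); last by case: K.
  by rewrite meet_facets_above //; apply; apply/fK => //; case: K.
move=> [G [PG FG] <-]; split; first by have [] := fP G PG.
by apply: dual_map_sub iQP _ PG _ => //; rewrite meet_facets_above.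
Qed.

Lemma face_mapK F : is_face P F -> psi (phi F) = F.
Proof.
have [->|/set0P F0] := eqVneq F set0.
  by rewrite face_map0 => _; rewrite -subset0 => y [[]].
move=> PF; apply/seteqP; split=> y.
  move=> [_]; rewrite face_map_above // (image_inv iPQ); last by move=> G [].
  by rewrite meet_facets_above.
move=> Fy; split; first exact: face_map_neq0.
rewrite face_map_above // (image_inv iPQ); last by move=> G [].
by rewrite meet_facets_above.
Qed.

Lemma face_mapS F G : F `<=` G -> phi F `<=` phi G.
Proof.
move=> FG y [[z Fz] [Qy Iy]]; split; first by exists z; exact: FG.
split=> // _ [H [PH GH] <-]; apply: Iy; exists H => //; split=> //.
exact: subset_trans FG GH.
Qed.

End FaceMap.

(** Descending from [G] to [F] through successive facets lowers the dimension by exactly one per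
    step. The images under the injective monotone [phi] are strictly nested, so their dimension
    drops by at least one per step. *)
Lemma adim_strict_mono d1 d2 (P : set 'rV[R]_d1) (Q : set 'rV[R]_d2)
    (phi : set 'rV[R]_d1 -> set 'rV[R]_d2) :
  is_polytope P -> (forall F, is_face P F -> is_face Q (phi F)) ->
  (forall F G, is_face P F -> is_face P G -> F `<=` G -> phi F `<=` phi G) ->
  (forall F G, is_face P F -> is_face P G -> phi F = phi G -> F = G) ->
  forall F G, is_face P F -> is_face P G -> F !=set0 -> F `<=` G ->
  adim (phi F) + adim G <= adim (phi G) + adim F.
Proof.
move=> pP phif phiS phiI F G PF PG F0 FG.
have [k] := ubnP (absz (adim G - adim F)).
elim: k G PG FG => // k IH G PG FG ltk.
have [->//|FnG] := pselect (F = G).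
have [y [Gy nFy]] : exists y, G y /\ ~ F y.
  apply/not_existsP => H; apply: FnG; apply/seteqP; split=> // y Gy.
  by apply: contrapT => nFy; apply: (H y).
have GF := face_of_sub PF PG FG.
have pG := face_polytope pP PG.
(* Separation is applied inside the polytope [G], to get a facet of [G] that contains [F]. *)
have [G' [[GG' G'0 dG'] FG' nG'y]] := facet_separation pG GF F0 Gy nFy.
have PG' := face_trans pP PG GG'.
have lt1 : adim F < adim G by apply: face_lt_adim.
have le1 : adim F <= adim G' by apply: adimS.
have lt2 : adim (phi G') < adim (phi G).
  apply: face_lt_adim; last by move=> /phiI E; apply: nG'y; rewrite E.
  by apply: face_of_sub; [exact: phif|exact: phif|apply: phiS => //; exact: face_sub GG'].
have := IH G' PG' FG'; rewrite dG' in le1 *; lia.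
Qed.

Lemma dual_comb_iso d1 d2 (P : set 'rV[R]_d1) (Q : set 'rV[R]_d2) :
  is_polytope P -> is_polytope Q -> adim P = adim Q ->
  complex_iso (dual_complex P) (dual_complex Q) -> comb_iso P Q.
Proof.
move=> pP pQ dPQ /(complex_iso_inv set0)[f [g []]].
rewrite !dual_vertices => fP gQ fK gK.
have iPQ : dual_map P Q f g by [].
have iQP : dual_map Q P g f by [].
pose phi := face_map P Q f; pose psi := face_map Q P g.
have phiK F : is_face P F -> psi (phi F) = F by exact: face_mapK.
have psiK F : is_face Q F -> phi (psi F) = F by exact: face_mapK.
have phif F : is_face P F -> is_face Q (phi F) by exact: (face_map_face pQ iPQ).
have psif F : is_face Q F -> is_face P (psi F) by exact: (face_map_face pP iQP).
have phiS F G : F `<=` G -> phi F `<=` phi G by exact: face_mapS.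
have psiS F G : F `<=` G -> psi F `<=` psi G by exact: face_mapS.
exists phi; split.
- split.
  + by move=> F /phif.
  + by move=> F G; rewrite !inE => PF PG E; rewrite -(phiK F) // E phiK.
  + by move=> F QF; exists (psi F); [exact: psif|exact: psiK].
- move=> F G PF PG; split; first exact: phiS.
  by move=> /psiS; rewrite !phiK.
- move=> F PF; have [->|/set0P F0] := eqVneq F set0.
    by rewrite /phi face_map0 // !adim_set0.
  have phiF0 : phi F !=set0 by exact: (face_map_neq0 iPQ).
  (* Comparing [F] with [P] under [phi] bounds [adim (phi F)] by [adim F]; comparing [phi F] with
     [Q] under [psi] gives the converse, as [P] and [Q] have equal dimension. *)
  have := @adim_strict_mono _ _ P Q phi pP phif (fun F G _ _ => phiS F G) _
    F P PF (face_refl P) F0 (face_sub PF).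
  have := @adim_strict_mono _ _ Q P psi pQ psif (fun F G _ _ => psiS F G) _
    (phi F) Q (phif F PF) (face_refl Q) phiF0 (face_sub (phif F PF)).
  have := adimS (face_sub (phif P (face_refl P))).
  have := adimS (face_sub (psif Q (face_refl Q))).
  rewrite phiK // => le1 le2 H1 H2.
  have {}H1 := H1 (fun F G QF QG E => etrans (esym (psiK F QF)) (etrans (congr1 phi E) (psiK G QG))).
  have {}H2 := H2 (fun F G QF QG E => etrans (esym (phiK F QF)) (etrans (congr1 psi E) (phiK G QG))).
  lia.
Qed.

End CombIso.

(** * Permutahedron *)

Section Permutahedron.
Variables (R : realType) (n : nat) (x : 'rV[R]_n.+1).
Hypothesis gx : generic x.
Implicit Types (A B : {set 'I_n.+1}) (s : 'S_n.+1) (c : 'rV[R]_n.+1).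
Local Notation P := (permutahedron x).
Local Notation pt s := (col_perm s x).

Definition indicator A : 'rV[R]_n.+1 := \row_i (i \in A)%:R.

Definition on_top A s := forall i j, i \in A -> j \notin A -> x 0 (s j) < x 0 (s i).

Definition nontrivial A := (exists i, i \in A) /\ (exists j, j \notin A).

Lemma pt_in s : P (pt s).
Proof. by apply: sub_conv_hull; exists s. Qed.

Lemma permutahedron_polytope : is_polytope P.
Proof.
exists [seq pt s | s <- enum [set: 'S_n.+1]%SET]; congr conv_hull.
apply/seteqP; split=> y /=.
  by move=> [s _ <-]; apply/mapP; exists s; rewrite ?mem_enum ?finset.in_setT.
by move=> /mapP[s _ ->]; exists s.
Qed.

Lemma dot_pt c s : dot c (pt s) = \sum_i c 0 i * x 0 (s i).
Proof. by apply: eq_bigr => i _; rewrite mxE. Qed.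

(** The exchange identity behind both the sorting of maximisers and the rigidity of functionals
    constant on a face. *)
Lemma dot_pt_tperm c s i j : dot c (pt (tperm i j * s)%g) =
  dot c (pt s) - (c 0 i - c 0 j) * (x 0 (s i) - x 0 (s j)).
Proof.
rewrite !dot_pt; have [->|ij] := eqVneq i j.
  by rewrite tperm1 mul1g !subrr mul0r subr0.
have ji : j != i by rewrite eq_sym.
rewrite [in LHS](bigD1 i) //= [in LHS](bigD1 j) //=.
rewrite [in RHS](bigD1 i) //= [in RHS](bigD1 j) //=.
rewrite !permM tpermL tpermR.
rewrite (eq_bigr (fun k => c 0 k * x 0 (s k))); first by ring.
by move=> k /andP[ki kj]; rewrite permM tpermD // eq_sym.
Qed.

(** A rearrangement argument: swapping two entries in the wrong order would increase the value, and
    genericity rules out ties. *)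
Lemma max_pt_sorted c s : (forall s', dot c (pt s') <= dot c (pt s)) ->
  forall i j, c 0 j < c 0 i -> x 0 (s j) < x 0 (s i).
Proof.
move=> smax i j cji; rewrite ltNge le_eqVlt; apply/negP => /orP[/eqP E|xij].
  suff /gx/eqP/(_ E) : s i != s j by [].
  by rewrite (inj_eq perm_inj); apply: contraTneq cji => ->; rewrite ltxx.
have := smax (tperm i j * s)%g; rewrite dot_pt_tperm => ?; nra.
Qed.

Lemma exists_max_pt c : exists s, forall s', dot c (pt s') <= dot c (pt s).
Proof.
have [s _ smax] := @arg_maxP _ _ _ (1%g : 'S_n.+1) xpredT (fun s => dot c (pt s)) isT.
by exists s => s'; apply: smax.
Qed.

Lemma max_dot c s : (forall s', dot c (pt s') <= dot c (pt s)) ->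
  forall y, P y -> dot c y <= dot c (pt s).
Proof. by move=> smax; apply: conv_hull_le => _ [s' _ <-]. Qed.

(* For a threshold t between the entries of pt s in and outside A, the sum over
   A of the entries minus t is at most the sum of all positive parts, which does
   not depend on the permutation and is attained at s. *)
Lemma on_top_max A s : on_top A s ->
  forall s', dot (indicator A) (pt s') <= dot (indicator A) (pt s).
Proof.
move=> sA s'.
have dE s1 t : dot (indicator A) (pt s1) =
    \sum_(i in A) (x 0 (s1 i) - t) + \sum_(i in A) t.
  rewrite -big_split dot_pt [RHS]big_mkcond; apply: eq_bigr => i _.
  by rewrite mxE; case: (i \in A) => /=; rewrite ?mul1r ?mul0r ?subrK.
have [A0|[i0 i0A]] := set_0Vmem A.
  have dot0 s1 : dot (indicator A) (pt s1) = 0.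
    by rewrite dot_pt big1 // => i _; rewrite mxE A0 finset.in_set0 mul0r.
  by rewrite !dot0.
have [m mA mmin] := @arg_minP _ _ _ i0 (mem A) (fun i => x 0 (s i)) i0A.
pose t := x 0 (s m).
rewrite !(dE _ t) lerD2r.
pose h s1 := \sum_i Num.max (x 0 (s1 i) - t) 0.
have hE s1 : h s1 = \sum_k Num.max (x 0 k - t) 0.
  by rewrite [RHS](reindex_inj (@perm_inj _ s1)).
apply: (@le_trans _ _ (h s')).
  rewrite big_mkcond; apply: ler_sum => i _.
  by case: ifP; rewrite le_max lexx ?orbT.
rewrite hE -(hE s) [leRHS]big_mkcond; apply: ler_sum => i _; case: ifPn => iA.
  by rewrite ge_max lexx subr_ge0; exact: mmin.
by rewrite ge_max lexx andbT subr_le0 ltW // sA.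
Qed.

Lemma exists_on_top A : exists s, on_top A s.
Proof.
have [s /max_pt_sorted sA] := exists_max_pt (indicator A).
by exists s => i j iA jA; apply: sA; rewrite !mxE iA (negPf jA) ltr01.
Qed.

(** The face maximising the coordinate sum over [A]. Comparing with every vertex avoids choosing a
    maximiser. *)
Definition top_face A : set 'rV[R]_n.+1 :=
  [set y | P y /\ forall s, dot (indicator A) (pt s) <= dot (indicator A) y].

Lemma top_faceE A s : on_top A s -> top_face A =
  [set y | P y /\ dot (indicator A) y = dot (indicator A) (pt s)].
Proof.
move=> /on_top_max sA; apply/seteqP; split=> y [Py yA]; split=> //.
  by apply/eqP; rewrite eq_le yA andbT max_dot.
by move=> s'; rewrite yA.
Qed.

Lemma top_face_face A : is_face P (top_face A).
Proof.
have [s sA] := exists_on_top A; rewrite (top_faceE sA).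
by exists (indicator A), (dot (indicator A) (pt s)); split=> //; exact/max_dot/on_top_max.
Qed.

Lemma top_face_pt A s : top_face A (pt s) <-> on_top A s.
Proof.
split=> [[_ /max_pt_sorted sA] i j iA jA|sA].
  by apply: sA; rewrite !mxE iA (negPf jA) ltr01.
by split; [exact: pt_in|exact: on_top_max].
Qed.

Lemma on_top_tperm A s i j : (i \in A) = (j \in A) -> on_top A s ->
  on_top A (tperm i j * s)%g.
Proof.
move=> ij sA k l kA lA; have tA m : (tperm i j m \in A) = (m \in A).
  by case: tpermP => // ->.
by rewrite !permM; apply: sA; rewrite tA.
Qed.

(** Swapping two coordinates on the same side of [A] keeps a vertex on the face. The exchange
    identity then forces equal coefficients, as the entries are distinct. *)
Lemma const_on_top_face A c b : (forall y, top_face A y -> dot c y = b) ->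
  forall i j, (i \in A) = (j \in A) -> c 0 i = c 0 j.
Proof.
move=> cb i j ijA; have [//|ij] := eqVneq (c 0 i) (c 0 j).
have [s sA] := exists_on_top A.
have := cb _ ((top_face_pt _ _).2 (on_top_tperm ijA sA)).
rewrite dot_pt_tperm (cb _ ((top_face_pt _ _).2 sA)).
move/eqP; rewrite subr_eq addrC -subr_eq subrr eq_sym mulf_eq0 !subr_eq0 (negPf ij) /=.
by rewrite (negPf (gx _)) // (inj_eq perm_inj); apply: contraNneq ij => ->.
Qed.

Lemma const_on_permutahedron c b : (forall y, P y -> dot c y = b) ->
  forall i, c = const_mx (c 0 i).
Proof.
move=> cb i; apply/rowP => j; rewrite mxE.
(* With the empty set, all coordinates lie on the same side. *)
apply: (@const_on_top_face finset.set0 c b) => [y [/cb]//|].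
by rewrite !finset.in_set0.
Qed.

Lemma dot_const a y : dot (const_mx a : 'rV[R]_n.+1) y = a * \sum_i y 0 i.
Proof. by rewrite mulr_sumr; apply: eq_bigr => i _; rewrite mxE. Qed.

Lemma sum_permutahedron y : P y -> \sum_i y 0 i = \sum_i x 0 i.
Proof.
move=> Py; rewrite -[LHS]mul1r -dot_const.
apply: conv_hull_eq Py => _ [s _ <-].
rewrite dot_const mul1r [RHS](reindex_inj (@perm_inj _ s)).
by apply: eq_bigr => i _; rewrite mxE.
Qed.

(** The equations valid on [P] are the multiples of the fixed coordinate sum. One extra point [z]
    with a different sum destroys them all, so [P] has codimension one. *)
Lemma adim_permutahedron : adim P = n%:Z.
Proof.
pose z : 'rV[R]_n.+1 := (\sum_i x 0 i + 1) *: delta_mx 0 0.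
have zE : \sum_i z 0 i = \sum_i x 0 i + 1.
  rewrite (bigD1 0) //= big1 => [|i i0]; rewrite !mxE ?eqxx ?mulr1 ?addr0 //.
  by rewrite (negPf i0) mulr0.
have lt : adim P < adim [set: 'rV[R]_n.+1].
  apply: (@adim_lt _ _ _ _ (const_mx 1) (\sum_i x 0 i) z) => //.
    by move=> y Py; rewrite dot_const mul1r sum_permutahedron.
  by rewrite dot_const mul1r zE -subr_eq0 addrAC subrr add0r oner_eq0.
have : adim [set: 'rV[R]_n.+1] <= adim (P `|` [set z]).
  apply: adim_le => c b cb y _.
  have cP w : P w -> dot c w = b by move=> Pw; apply: cb; left.
  have cE := const_on_permutahedron cP 0.
  have := cP _ (pt_in 1); have := cb z (or_intror erefl).
  rewrite cE !dot_const zE (sum_permutahedron (pt_in 1)) mulrDr mulr1.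
  move=> <- /eqP; rewrite -subr_eq0 opprD addNKr oppr_eq0 => /eqP->.
  by rewrite !mul0r addr0.
have := adimU1 P z; move: lt; rewrite adim_setT; lia.
Qed.

(** * Facets of the permutahedron *)

Lemma exists_not_on_top A : nontrivial A -> exists s, ~ on_top A s.
Proof.
move=> [[i iA] [j jA]]; have [s sA] := exists_on_top A.
exists (tperm i j * s)%g => /(_ i j iA jA); rewrite !permM tpermL tpermR.
by rewrite ltNge ltW // sA.
Qed.

(** A functional constant on the face has one coefficient on [A] and one off [A]. If it takes the
    same value at a vertex off the face, these agree, and only equations valid on all of [P]
    remain. *)
Lemma adim_top_face A : nontrivial A -> adim (top_face A) = adim P - 1.
Proof.
move=> nA; have [s1 nsA] := exists_not_on_top nA.
have [[i0 i0A] [j0 j0A]] := nA; have [s sA] := exists_on_top A.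
have lt : adim (top_face A) < adim P.
  apply: face_lt_adim; first exact: top_face_face.
  by move=> E; apply: nsA; apply/top_face_pt; rewrite E; exact: pt_in.
have : adim P <= adim (top_face A `|` [set pt s1]).
  apply: adim_le => c b cb y Py.
  have cA z : top_face A z -> dot c z = b by move=> Az; apply: cb; left.
  have cE : c = const_mx (c 0 j0) + (c 0 i0 - c 0 j0) *: indicator A.
    apply/rowP => i; rewrite !mxE; case: (boolP (i \in A)) => iA.
      by rewrite mulr1 addrC subrK; apply: (const_on_top_face cA); rewrite iA i0A.
    by rewrite mulr0 addr0; apply: (const_on_top_face cA); rewrite (negPf iA) (negPf j0A).
  have dE z : P z -> dot c z = c 0 j0 * (\sum_i x 0 i)
      + (c 0 i0 - c 0 j0) * dot (indicator A) z.
    by move=> Pz; rewrite {1}cE dotDl dotZl dot_const sum_permutahedron.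
  have c0 : c 0 i0 - c 0 j0 = 0.
    have := cA _ ((top_face_pt _ _).2 sA); have := cb _ (or_intror erefl).
    rewrite !dE; try exact: pt_in.
    move=> <- /addrI/eqP; rewrite -subr_eq0 -mulrBr mulf_eq0 => /orP[/eqP//|].
    rewrite subr_eq0 => /eqP E; case: nsA; apply/top_face_pt.
    by rewrite (top_faceE sA); split; [exact: pt_in|].
  have := cA _ ((top_face_pt _ _).2 sA).
  by rewrite !dE //; [rewrite c0 !mul0r|exact: pt_in].
have := adimU1 (top_face A) (pt s1); lia.
Qed.

Lemma top_face_facet A : nontrivial A -> is_facet P (top_face A).
Proof.
move=> nA; split; [exact: top_face_face| |exact: adim_top_face].
by have [s sA] := exists_on_top A; exists (pt s); apply/top_face_pt.
Qed.

Lemma face_pt F : is_face P F -> F !=set0 -> exists s, F (pt s).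
Proof.
move=> [c [b [cb ->]]] [y [Py cy]].
have [z|_ [[s _ <-] cs]] := conv_hull_neq0 (conv_hull_face _ Py cy).
  by move=> Az; apply: cb; exact: sub_conv_hull.
by exists s; split=> //; exact: pt_in.
Qed.

(** The vertices of [F] are sorted along the exposing functional, so the set [A] of its largest
    coefficients is on top at each of them. Thus [F] lies in [top_face A], and equal dimensions give
    equality. *)
Lemma facet_top_face F : is_facet P F -> exists2 A, nontrivial A & F = top_face A.
Proof.
move=> [PF F0 dF]; have [c [b [cb FE]]] := PF.
have [s Fs] := face_pt PF F0.
have csb : dot c (pt s) = b by move: Fs; rewrite FE => -[].
have [m _ mmax] := @arg_maxP _ _ _ (0 : 'I_n.+1) xpredT (fun i => c 0 i) isT.
(* The coordinates where the exposing functional is largest. *)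
pose A : {set 'I_n.+1} := [set i | c 0 i == c 0 m]%SET.
have ltA i j : i \in A -> j \notin A -> c 0 j < c 0 i.
  rewrite !inE => /eqP-> cj; rewrite lt_neqAle cj; exact: mmax.
have nA : nontrivial A.
  split; first by exists m; rewrite inE.
  apply: contrapT => H; have cE : c = const_mx (c 0 m).
    apply/rowP => j; rewrite mxE; apply/eqP; apply: contrapT => cj; apply: H.
    by exists j; rewrite inE; apply/negP.
  have FP : F = P.
    rewrite FE; apply/seteqP; split=> y; [by case|move=> Py; split=> //].
    rewrite -csb cE [LHS]dot_const dot_const.
    by rewrite !sum_permutahedron //; exact: pt_in.
  by move: dF; rewrite FP; lia.
exists A => //; have FA : F `<=` top_face A.
  move=> y; have [s1 s1A] := exists_on_top A.
  rewrite FE (top_faceE s1A) => -[Py cy]; split=> //.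
  have cbA z : [set pt s | s in [set: 'S_n.+1]] z -> dot c z <= b.
    by move=> Az; apply: cb; exact: sub_conv_hull.
  apply: conv_hull_eq (conv_hull_face cbA Py cy) => z [[s2 _ <-] cs2].
  have : top_face A (pt s2).
    apply/top_face_pt => i j iA jA; apply: (@max_pt_sorted c); last exact: ltA.
    by move=> s'; rewrite cs2; apply: cb; exact: pt_in.
  by rewrite (top_faceE s1A) => -[].
apply: contrapT => FnA.
have := face_lt_adim (face_of_sub PF (top_face_face A) FA) FnA.
by rewrite adim_top_face // dF ltxx.
Qed.

(** The indicator of [B] is constant on the face, hence constant on each side of [A], so [B] is [A]
    or its complement. The complement is excluded because a common vertex would order [i0] and [j0]
    both ways. *)
Lemma top_face_inj A B : nontrivial A -> nontrivial B ->
  top_face A = top_face B -> A = B.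
Proof.
move=> [[i0 i0A] [j0 j0A]] [[i1 i1B] [j1 j1B]] E.
have [s sA] := exists_on_top A.
have sB : on_top B s by apply/top_face_pt; rewrite -E; apply/top_face_pt.
have constB i j : (i \in A) = (j \in A) -> (i \in B) = (j \in B).
  have /const_on_top_face/(_ i j) : forall y, top_face A y ->
      dot (indicator B) y = dot (indicator B) (pt s).
    by move=> y; rewrite E (top_faceE sB) => -[].
  move=> /[apply]; rewrite !mxE => /eqP; rewrite eqr_nat.
  by case: (i \in B); case: (j \in B).
have inB i : (i \in B) = if i \in A then i0 \in B else j0 \in B.
  by case: (boolP (i \in A)) => iA; apply: constB; rewrite ?iA ?i0A ?(negPf iA) ?(negPf j0A).
have [i0B|i0B] := boolP (i0 \in B); have [j0B|j0B] := boolP (j0 \in B).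
- by move: j1B; rewrite inB i0B j0B if_same.
- by apply/setP => i; rewrite inB i0B (negPf j0B); case: (i \in A).
- by have := sA _ _ i0A j0A; rewrite ltNge ltW // sB.
- by move: i1B; rewrite inB (negPf i0B) (negPf j0B) if_same.
Qed.

(** Facets that meet share a vertex, and sets on top at one vertex are nested initial segments of
    its ordering. Conversely, a chain is on top at a vertex sorted compatibly with it. *)
Lemma top_face_dual (C : set {set 'I_n.+1}) : (forall A, C A -> nontrivial A) ->
  dual_complex P (top_face @` C) <->
  (forall A B, C A -> C B -> A \subset B \/ B \subset A).
Proof.
move=> nC; split=> [[_ I0] A B CA CB|chain].
  have [|s [_ Is]] := face_pt _ I0.
    by apply: face_bigcap permutahedron_polytope _ => _ [D _ <-]; exact: top_face_face.
  have sA : on_top A s by apply/top_face_pt; apply: Is; exists A.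
  have sB : on_top B s by apply/top_face_pt; apply: Is; exists B.
  have [|/fintype.subsetPn[i iA iB]] := boolP (A \subset B); first by left.
  right; apply/fintype.subsetP => j jB; apply: contraT => jA.
  by have := sA _ _ iA jA; rewrite ltNge ltW // sB.
split; first by move=> _ [A /nC/top_face_facet ? <-].
(* Weight each coordinate by the number of members of the chain containing it. If [i] is in [A] and
   [j] is not, any member containing [j] contains [A], hence [i], and [A] itself makes the
   comparison strict. *)
pose c : 'rV[R]_n.+1 := \row_i #|[set A : {set 'I_n.+1} | `[< C A >] && (i \in A)]%SET|%:R.
have [s /max_pt_sorted sc] := exists_max_pt c.
exists (pt s); split; first exact: pt_in.
move=> _ [A CA <-]; apply/top_face_pt => i j iA jA; apply: sc.
rewrite !mxE ltr_nat; apply/proper_card/properP; split.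
  apply/fintype.subsetP => B; rewrite !inE => /andP[/asboolP CB jB].
  have [/fintype.subsetP AB|/fintype.subsetP BA] := chain A B CA CB.
    by rewrite AB // andbT; apply/asboolP.
  by rewrite BA in jA.
exists A; rewrite inE; first by rewrite iA andbT; apply/asboolP.
by rewrite (negPf jA) andbF.
Qed.

(** The facets through [pt s] correspond to the [n] nonempty proper initial segments of the
    coordinates listed by decreasing entry. *)
Lemma permutahedron_simple : simple_polytope n P.
Proof.
split; [exact: permutahedron_polytope|exact: adim_permutahedron|].
move=> v vP; have [|s vs] := face_pt vP; first by exists v.
move: vs => /= <- {v vP}.
pose rk i := #|[set j | x 0 (s i) < x 0 (s j)]%SET|.
have rk_lt i j : (rk i < rk j)%N = (x 0 (s j) < x 0 (s i)).
  have lt k l : x 0 (s l) < x 0 (s k) -> (rk k < rk l)%N.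
    move=> xlk; apply/proper_card/properP; split.
      by apply/fintype.subsetP => m; rewrite !inE; exact: lt_trans.
    by exists k; rewrite !inE ?ltxx.
  apply/idP/idP => [rij|/lt//]; rewrite ltNge le_eqVlt; apply/negP => /orP[/eqP E|/lt].
    by move: rij; rewrite /rk E ltnn.
  by rewrite ltnNge ltnW.
have rk_inj : injective rk.
  move=> i j E; apply/eqP/negPn; rewrite -(inj_eq (@perm_inj _ s)).
  apply/negP => /gx; rewrite neq_lt -!rk_lt E ltnn //.
have rk_le i : (rk i < n.+1)%N.
  rewrite -[X in (_ < X)%N](card_ord n.+1) -cardsT; apply/proper_card/properP.
  by split; [exact: finset.subsetT|exists i; rewrite !inE ?ltxx].
pose rko i := Ordinal (rk_le i).
have rko_inj : injective rko by move=> i j /(congr1 val)/rk_inj.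
have [rkinv _ rkK] := injF_bij rko_inj.
have rk_surj k : (k < n.+1)%N -> exists i, rk i = k.
  by move=> kn; exists (rkinv (Ordinal kn)); have /(congr1 val) := rkK (Ordinal kn).
(* Ranks start at 0 for the largest entry, so [L k] has [k + 1] elements and is proper exactly for
   [k < n]. *)
pose L k : {set 'I_n.+1} := [set i | (rk i <= k)%N]%SET.
have nL k : (k < n)%N -> nontrivial (L k).
  move=> kn; have [i ri] := rk_surj 0%N isT; have [j rj] := rk_surj n (ltnSn n).
  by split; [exists i|exists j]; rewrite inE ?ri ?rj // -ltnNge.
have topL k : on_top (L k) s.
  by move=> i j; rewrite !inE -ltnNge => rik rkj; rewrite -rk_lt (leq_ltn_trans rik).
rewrite card_eq_sym; apply/card_set_bijP; exists (top_face \o L); split.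
- move=> k /= kn; split; first exact/top_face_facet/nL.
  exact/top_face_pt.
- move=> k l; rewrite !inE => kn ln /(top_face_inj (nL k kn) (nL l ln))/setP LE.
  apply/eqP; rewrite eqn_leq; apply/andP; split.
    by have [i ri] := rk_surj k (leqW kn); have := LE i; rewrite !inE ri leqnn => <-.
  by have [i ri] := rk_surj l (leqW ln); have := LE i; rewrite !inE ri leqnn => ->.
- move=> F [/facet_top_face[A nA ->] /top_face_pt sA].
  have [[i0 i0A] [j0 j0A]] := nA.
  (* A set on top contains every coordinate ranked before any of its members, so it is the segment
     ending at its member of largest rank. *)
  have [m mA mmax] := @arg_maxnP _ i0 (mem A) rk i0A.
  exists (rk m).
    by rewrite /= -ltnS; apply: leq_trans (rk_le j0); rewrite ltnS rk_lt sA.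
  congr top_face; apply/setP => i; rewrite inE.
  apply/idP/idP => [rim|/mmax//]; apply: contraT => iA.
  by move: rim; rewrite leqNgt rk_lt sA.
Qed.

End Permutahedron.

(** * Tubings *)

Section Chains.
Variable n : nat.
Implicit Types (A B : {set 'I_n.+1}) (t u : {set pm n}).
Local Notation top := (@ord_max n).

(** The order complex of the nonempty proper subsets, that is, the barycentric subdivision of the
    boundary of the n-simplex. It mediates between facets and tubes. *)
Definition chains : set (set {set 'I_n.+1}) :=
  [set C | (forall A, C A -> nontrivial A) /\
           (forall A B, C A -> C B -> A \subset B \/ B \subset A)].

Lemma chains_vertices : complex_vertices chains = @nontrivial n.
Proof.
apply/seteqP; split=> A; first by move=> [/(_ A erefl)].
by move=> nA; split=> [_ ->|_ _ -> ->] //; left.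
Qed.

Lemma subset_lift A B : (top \in A -> top \in B) ->
  (forall i, lift top i \in A -> lift top i \in B) -> A \subset B.
Proof.
by move=> AB0 AB; apply/fintype.subsetP => j; case: (unliftP top j) => [i|] ->; auto.
Qed.

(** No edge joins opposite signs, so a connected set has one sign; each sign class is a clique, so
    all its nonempty subsets are connected. *)
Lemma two_complete_tubeP t : is_tube (@two_complete n) t <->
  exists (b : bool) (S : {set 'I_n}),
    (exists i, i \in S) /\ t = [set v | (v.1 \in S) && (v.2 == b)]%SET.
Proof.
split=> [[t0 conn _]|[b [S [[i0 i0S] ->]]]].
  have [//|[v0 v0t]] := set_0Vmem t.
  have sgn v : v \in t -> v.2 == v0.2.
    move=> vt; have := conn _ _ v0t vt.
    move/(@closed_connect _ _ [pred v | v.2 == v0.2]); rewrite !inE eqxx => <- //.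
    by move=> a b /and3P[_ _ /andP[/eqP ab _]]; rewrite !inE ab.
  exists v0.2, [set i | (i, v0.2) \in t]%SET; split.
    by exists v0.1; rewrite inE -surjective_pairing.
  apply/setP => -[i b]; rewrite !inE /=; apply/idP/andP => [vt|[vt /eqP->//]].
  by have /eqP /= bE := sgn _ vt; rewrite -bE.
split.
- by move=> /setP/(_ (i0, b)); rewrite !inE i0S eqxx.
- move=> v w vt wt; have [<-|vw] := eqVneq v w; first exact: connect0.
  apply: connect1; apply/and3P; split=> //; move: vt wt vw; rewrite !inE /=.
  case: v w => [i b1] [j b2] /= /andP[_ /eqP->] /andP[_ /eqP->].
  by move=> ne; apply/andP; split=> //=; apply: contraNneq ne => ->.
- by move=> [k c]; rewrite !inE /= => /andP[_ /eqP->]; case: b; rewrite andbF.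
Qed.

(* A subset avoiding the last index is a positive tube; for one containing it,
   the complement is a negative tube. *)
Definition tube_of A : {set pm n} :=
  [set v | (v.2 != (top \in A)) && ((lift top v.1 \in A) == v.2)]%SET.

Lemma tube_of_neq0 A : nontrivial A -> exists i, (i, top \notin A) \in tube_of A.
Proof.
move=> [[i iA] [j jA]].
have [k kA] : exists k, (lift top k \in A) = (top \notin A).
  case: (boolP (top \in A)) => mA.
    case: (unliftP top j) jA => [k ->|->]; last by rewrite mA.
    by exists k; apply/negbTE.
  case: (unliftP top i) iA => [k ->|->]; last by rewrite (negPf mA).
  by exists k.
by exists k; rewrite inE /= kA eqxx andbT; case: (top \in A).
Qed.

Lemma tube_of_tube A : nontrivial A -> is_tube (@two_complete n) (tube_of A).
Proof.
move=> /tube_of_neq0[i iA]; apply/two_complete_tubeP.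
exists (top \notin A), [set k | (lift top k \in A) == (top \notin A)]%SET.
split; first by exists i; move: iA; rewrite !inE /= => /andP[].
apply/setP => -[k b]; rewrite !inE /=.
by case: b; case: (top \in A); rewrite ?andbT ?andbF.
Qed.

Lemma tube_of_inj A B : nontrivial A -> nontrivial B -> tube_of A = tube_of B -> A = B.
Proof.
move=> /tube_of_neq0[i iA] nB E.
have topE : (top \in A) = (top \in B).
  by move: (iA); rewrite E inE /= => /andP[]; case: (top \in A); case: (top \in B).
apply/setP => j; case: (unliftP top j) => [k|] -> //.
move/setP/(_ (k, top \notin A)): E; rewrite !inE /= topE.
by case: (top \in B); case: (_ \in A); case: (_ \in B).
Qed.

Lemma tube_of_surj t : is_tube (@two_complete n) t ->
  exists2 A, nontrivial A & tube_of A = t.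
Proof.
move=> /two_complete_tubeP[b [S [[i iS] ->]]].
have [A [topA liftA]] : exists A : {set 'I_n.+1},
    (top \in A) = ~~ b /\ forall k, (lift top k \in A) = ((k \in S) == b).
  exists [set j | if unlift top j is Some k then (k \in S) == b else ~~ b]%SET.
  by split=> [|k]; rewrite inE ?unlift_none ?liftK.
exists A; last first.
  apply/setP => -[k c]; rewrite !inE /= topA liftA.
  by case: b {topA liftA}; case: c; case: (k \in S).
split; case: b topA liftA => topA liftA.
- by exists (lift top i); rewrite liftA iS.
- by exists top; rewrite topA.
- by exists top; rewrite topA.
- by exists (lift top i); rewrite liftA iS.
Qed.

(** If [A] and [B] agree at [top], their tubes have the same sign and lie in one clique, so
    compatibility means nesting, reversed for negative tubes by complementation. Otherwise the signs
    differ and no edge joins the tubes; the absence of antipodal pairs then says that the set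
    avoiding [top] lies in the one containing it. *)
Lemma compatible_tube_of A B : nontrivial A -> nontrivial B ->
  (weakly_compatible (@two_complete n) (tube_of A) (tube_of B) /\
   forall v, v \in tube_of A -> antipode v \notin tube_of B) <->
  (A \subset B \/ B \subset A).
Proof.
move=> nA nB; have [i iA] := tube_of_neq0 nA; have [j jB] := tube_of_neq0 nB.
have [topE|topN] := eqVneq (top \in A) (top \in B).
  have anti v : v \in tube_of A -> antipode v \notin tube_of B.
    by rewrite !inE /= topE; case: v => k [] /=; case: (top \in B).
  have subE (C D : {set _}) : (top \in C) = (top \in D) ->
      (tube_of C \subset tube_of D) = if top \in C then D \subset C else C \subset D.
    move=> CD; apply/fintype.subsetP/idP => [sub|].
      case: ifP => tC; apply: subset_lift => [|k kC]; rewrite -?CD ?tC //.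
        apply: contraTT kC => kD; have := sub (k, false); rewrite !inE /= -CD tC.
        by rewrite (negPf kD) => /(_ isT); case: (_ \in D).
      by have := sub (k, true); rewrite !inE /= -CD tC kC => /(_ isT)/eqP.
    move=> + [k b]; rewrite !inE /= -CD; case: ifP => tC /fintype.subsetP sub.
      case: b => //=; rewrite !eqbF_neg; exact/contra/sub.
    by case: b => //=; rewrite !eqb_id; exact: sub.
  split=> [[comp _]|sub]; last first.
    split=> //; rewrite /weakly_compatible !subE //.
    by case: ifP => tA; rewrite -?topE tA; case: sub => ?;
      [constructor 2|constructor 1|constructor 1|constructor 2].
  case: comp => [||[disj noedge]].
  - by rewrite subE //; case: ifP; auto.
  - by rewrite subE //; case: ifP; auto.
  (* Disjoint tubes of the same sign contain distinct vertices of one clique, hence adjacent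
     ones. *)
  - have /negP[] := noedge _ _ iA jB; apply/andP; split; rewrite /= ?topE //.
    apply/eqP => ij; move/fintype.disjointFl: disj => /(_ _ jB).
    by rewrite -ij -topE iA.
have weak : weakly_compatible (@two_complete n) (tube_of A) (tube_of B).
  have sgn v w : v \in tube_of A -> w \in tube_of B -> v.2 != w.2.
    rewrite !inE => /andP[+ _] /andP[+ _]; move: topN.
    by case: (top \in A); case: (top \in B); case: v.2; case: w.2.
  constructor 3; split=> [|v w vA wB]; last first.
    by apply/negP => /andP[]; rewrite (negPf (sgn _ _ vA wB)).
  by apply/fintype.pred0P => v /=; apply/negP => /andP[/sgn vA /vA]; rewrite eqxx.
split=> [[_ anti]|sub].
  case: (boolP (top \in A)) => tA; have tB : (top \in B) = ~~ (top \in A).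
  - by move: topN; case: (top \in A); case: (top \in B).
  - right; apply: subset_lift => [|k kB]; first by rewrite tB tA.
    apply: contraT => kA; have := anti (k, false); rewrite !inE /= tB tA kB (negPf kA).
    by move=> /(_ isT).
  - by move: topN; case: (top \in A); case: (top \in B).
  - left; apply: subset_lift => [|k kA]; first by rewrite (negPf tA).
    apply: contraT => kB; have := anti (k, true); rewrite !inE /= tB kA (negPf tA) (negPf kB).
    by move=> /(_ isT).
split=> // -[k b]; rewrite !inE /=.
(* Only membership of [top] and [lift top k] matters, which reduces the claim to a finite Boolean
   check. *)
have : ((top \in A) ==> (top \in B)) && ((lift top k \in A) ==> (lift top k \in B))
    || ((top \in B) ==> (top \in A)) && ((lift top k \in B) ==> (lift top k \in A)).
  case: sub => /fintype.subsetP sub; apply/orP; [left|right];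
  by apply/andP; split; apply/implyP; exact: sub.
move: topN; case: (top \in A); case: (top \in B); case: (_ \in A); case: (_ \in B);
by case: b.
Qed.

Lemma tubing_vertices (e : rel (pm n)) : complex_vertices (is_tubing e) = is_tube e.
Proof.
apply/seteqP; split=> t; first by move=> [/(_ t erefl)].
move=> te; split=> [_ -> //|_ _ -> ->|_ _ v -> ->]; first by constructor 1.
by case: te => _ _; apply.
Qed.

Lemma chains_tubings : complex_iso chains (is_tubing (@two_complete n)).
Proof.
exists tube_of; rewrite chains_vertices tubing_vertices; split.
  split.
  - exact: tube_of_tube.
  - by move=> A B; rewrite !inE; exact: tube_of_inj.
  - by move=> t /tube_of_surj[A nA <-]; exists A.
move=> C nC; split=> [[_ chain]|[_ weak anti]].
  have comp A B : C A -> C B -> weakly_compatible (@two_complete n) (tube_of A) (tube_of B) /\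
      forall v, v \in tube_of A -> antipode v \notin tube_of B.
    by move=> CA CB; apply/compatible_tube_of; auto.
  split.
  - by move=> _ [A /nC nA <-]; exact: tube_of_tube.
  - by move=> _ _ [A CA <-] [B CB <-]; have [] := comp A B CA CB.
  - by move=> _ _ v [A CA <-] [B CB <-]; have [_] := comp A B CA CB; apply.
split=> // A B CA CB; apply/compatible_tube_of; [exact: nC|exact: nC|split].
  by apply: weak; [exists A|exists B].
by move=> v; apply: anti; [exists A|exists B].
Qed.

Lemma chains_dual (R : realType) (x : 'rV[R]_n.+1) : generic x ->
  complex_iso chains (dual_complex (permutahedron x)).
Proof.
move=> gx; exists (top_face x); rewrite chains_vertices dual_vertices; split.
  split.
  - by move=> A; exact: top_face_facet.
  - by move=> A B; rewrite !inE; exact: top_face_inj.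
  - by move=> F /(facet_top_face gx)[A nA ->]; exists A.
move=> C nC; split=> [[_ chain]|/(top_face_dual gx nC)]; last by [].
exact/top_face_dual.
Qed.

End Chains.

Theorem proposition6p1p20 (R : realType) (n : nat) (x : 'rV[R]_n.+1)
    (hx : generic x) :
  (exists (d : nat) (Q : set 'rV[R]_d),
      is_hypercube_graph_associahedron (@two_complete n) Q) /\
  (forall (d : nat) (P : set 'rV[R]_d),
      is_hypercube_graph_associahedron (@two_complete n) P ->
      comb_iso P (permutahedron x)).
Proof.
have sym := complex_iso_sym finset.set0 (chains_dual hx).
split.
  (* The permutahedron itself realises the tubing complex. *)
  exists n.+1, (permutahedron x); split; first exact: permutahedron_simple.
  exact: complex_iso_trans sym (chains_tubings n).
move=> d P [[pP dP _] isoP].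
apply: dual_comb_iso => //; first exact: permutahedron_polytope.
  by rewrite dP adim_permutahedron.
apply: complex_iso_trans isoP _.
apply: complex_iso_trans (chains_dual hx).
exact: complex_iso_sym finset.set0 (chains_tubings n).
Qed.
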